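(* Let $n\ge 1$ and let $p_1<p_2<\cdots<p_n$ be positive real numbers. Let $B$ be the $n\times n$ real symmetric matrix whose $(i,j)$ entry is $(p_i+p_j)^{p_i+p_j}$. Then $B$ is infinitely divisible, nonsingular and totally positive.
   Context: A real symmetric $n\times n$ matrix $S$ is positive semidefinite if $\langle x,Sx\rangle\ge 0$ for every vector $x\in\mathbb{R}^n$. A real symmetric matrix $S=[s_{ij}]$ with $s_{ij}\ge 0$ for all $i,j$ is called infinitely divisible if for every real number $r>0$ the entrywise (Hadamard) power $S^{\circ r}=[s_{ij}^r]$ is positive semidefinite. A matrix with nonnegative entries is called totally positive if all its minors (determinants of square submatrices of every size, formed from any choice of rows and any choice of columns, taken in increasing order) are nonnegative. *)

(* Defs.v *)
From mathcomp Require Import all_boot all_order all_algebra.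
From mathcomp Require Import reals exp.

Set Implicit Arguments.
Unset Strict Implicit.
Unset Printing Implicit Defensive.

Import Order.TTheory GRing.Theory Num.Theory.

Local Open Scope ring_scope.

Definition possemidef (R : realType) (n : nat) (S : 'M[R]_n) : Prop :=
  S^T = S /\ forall x : 'cV[R]_n, 0 <= (x^T *m (S *m x)) 0 0.

(* [powR] has the conventional value 0 `^ r = 0 for r > 0, so zero entries
   are treated as usual. *)
Definition hadamard_pow (R : realType) (m n : nat) (S : 'M[R]_(m, n)) (r : R)
    : 'M[R]_(m, n) :=
  map_mx (fun s => s `^ r) S.

Definition infinitely_divisible (R : realType) (n : nat) (S : 'M[R]_n) : Prop :=
  [/\ S^T = S,
      forall i j, 0 <= S i j
    & forall r : R, 0 < r -> possemidef (hadamard_pow S r)].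

(* Strictly increasing f and g list the chosen rows and columns of a k x k
   submatrix; they exist only when k is at most m and n. *)
Definition totally_positive (R : realType) (m n : nat) (A : 'M[R]_(m, n))
    : Prop :=
  (forall i j, 0 <= A i j) /\
  forall (k : nat) (f : 'I_k -> 'I_m) (g : 'I_k -> 'I_n),
    {homo f : i j / (i < j)%N} -> {homo g : i j / (i < j)%N} ->
    0 <= \det (mxsub f g A).

Definition powsum_mx (R : realType) (n : nat) (p : 'I_n -> R) : 'M[R]_n :=
  \matrix_(i, j) (p i + p j) `^ (p i + p j).

(* Main.v *)
Require Import Defs.
From mathcomp Require Import all_boot all_order all_algebra.
From mathcomp Require Import reals exp.
From mathcomp Require Import all_classical topology normedtype sequences.
From mathcomp Require Import derive realfun.
From mathcomp Require Import perm ring lra.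

Set Implicit Arguments.
Unset Strict Implicit.
Unset Printing Implicit Defensive.

Import Order.TTheory GRing.Theory Num.Theory numFieldNormedType.Exports.

Local Open Scope ring_scope.

(** Write f(t) = t^t. If f were a finite sum of w e^(a t) with w >= 0, the
matrix of all f(p_i + p_j) would be a nonnegative combination of the rank one
matrices with entries e^(a p_i) e^(a p_j), hence positive semidefinite. It
would also be totally positive: by Andreief's identity [andreief] its minors
are nonnegative combinations of products of two determinants of the form
det(e^(a_i x_j)), with the same exponents and with x increasing in both, and
such determinants have a sign that depends on the exponents only
[det_exp_same_sign]. Both properties survive pointwise limits, so it is enough
to show that f, and f^r for r > 0, is a limit of such exponential sums on every
finite set of positive reals ([laplace_limit]). Such limits are the functions
usually written as Laplace transforms of positive measures.

The class of limits is closed under sums, products and therefore under exp.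
The functions g such that exp(r g) is in the class for all r > 0
([log_laplace]) form a cone closed under limits, containing the affine functions
and the class itself. Three integrals, each replaced by Riemann sums of a monotone
integrand over [0, N] with mesh 1/N^2, climb up to t ln t:
- 1/t is the integral of e^(-s t) over s > 0 ([laplace_limit_inv]);
- - ln t is the limit of the integral of 1/(t + s) over [0, N], minus ln N
  ([log_laplace_ln]);
- t ln t is the limit of the integral of - ln(t + s) over [0, N], plus an
  affine function of t ([log_laplace_xlnx]).
Hence f^r = exp(r t ln t) is in the class.

Nonsingularity does not survive limits, and is obtained from growth. If c is
in the kernel, semidefiniteness of the matrix bordered by one more point y > 0
forces sum_i c_i f(p_i + y) = 0 ([laplace_limit_kernel]). Since f(b + y)
outgrows f(a + y) whenever a < b, letting y tend to infinity shows that the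
last nonzero coefficient vanishes ([selfpow_independent]). *)

(** * Limits of positive exponential sums *)

Section LaplaceLimits.
Variable R : realType.
Implicit Types (f g : R -> R) (T : seq R) (s : seq (R * R)) (t : R).
Local Open Scope classical_set_scope.

Lemma cvg_harmonic_bound (u : nat -> R) (l c : R) :
  (forall n, `|u n - l| <= c / n.+1%:R) -> u @ \oo --> l.
Proof.
move=> ule; have h0 : (fun n => c * @harmonic R n) @ \oo --> (0 : R).
  rewrite -(mulr0 c); apply: cvgM; [exact: cvg_cst|exact: cvg_harmonic].
apply/cvgrPdist_le => e e0.
move/cvgrPdist_le/(_ _ e0): h0; apply: filterS => n /=.
rewrite sub0r normrN distrC => h; apply: le_trans (ule n) _.
by apply: le_trans h; rewrite /harmonic /= ler_norm.
Qed.

(** A pair in [s] is a weight followed by an exponent. *)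
Definition expsum s t : R := \sum_(w <- s) w.1 * expR (w.2 * t).

(** Convergence is only asked on the finite list [T]: minors and quadratic
forms involve finitely many values of the function, and finiteness makes the
class closed under pointwise limits. *)
Definition laplace_limit T f : Prop :=
  exists s : nat -> seq (R * R),
    (forall n, all (fun w => 0 <= w.1) (s n)) /\
    {in T, forall t, (fun n => expsum (s n) t) @ \oo --> f t}.

Lemma near_all T (P : nat -> R -> Prop) :
  {in T, forall t, \forall n \near \oo, P n t} ->
  exists n, {in T, forall t, P n t}.
Proof.
move=> H; suff : \forall n \near \oo, {in T, forall t, P n t}.
  by case=> n _ /(_ n (leqnn n)) h; exists n.
elim: T H => [|a T IH] H; first exact: nearW.
have h1 : \forall n \near \oo, P n a by apply: H; rewrite mem_head.
have h2 : \forall n \near \oo, {in T, forall t, P n t}.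
  by apply: IH => t tT; apply: H; rewrite inE tT orbT.
apply: filterS2 h1 h2 => n h1 h2 t; rewrite inE => /orP[/eqP->//|]; exact: h2.
Qed.

Lemma laplace_limitP T f :
  (forall e, 0 < e -> exists2 s, all (fun w => 0 <= w.1) s &
     {in T, forall t, `|expsum s t - f t| <= e}) ->
  laplace_limit T f.
Proof.
move=> H; have H' n : exists s, all (fun w => 0 <= w.1) s /\
     {in T, forall t, `|expsum s t - f t| <= 1 / n.+1%:R}.
  have [|s s0 sT] := H (1 / n.+1%:R); first by rewrite divr_gt0.
  by exists s.
have [s hs] := choice H'; exists s; split=> [n|t tT]; first by have [] := hs n.
by apply: (@cvg_harmonic_bound _ _ 1) => n; have [_] := hs n; apply.
Qed.

(** A diagonal argument: by finiteness of [T] a single index is good at all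
points. *)
Lemma laplace_limit_lim T (u : nat -> R -> R) f :
  (forall n, laplace_limit T (u n)) ->
  {in T, forall t, (fun n => u n t) @ \oo --> f t} -> laplace_limit T f.
Proof.
move=> Hu uf; apply: laplace_limitP => e e0.
have e20 : 0 < e / 2 by rewrite divr_gt0.
have [n hn] : exists n, {in T, forall t, `|u n t - f t| <= e / 2}.
  apply: (@near_all T (fun n t => `|u n t - f t| <= e / 2)) => t tT.
  by move/cvgrPdist_le/(_ _ e20): (uf _ tT); apply: filterS => n /=; rewrite distrC.
have [s [s0 sT]] := Hu n.
have [m hm] : exists m, {in T, forall t, `|expsum (s m) t - u n t| <= e / 2}.
  apply: (@near_all T (fun m t => `|expsum (s m) t - u n t| <= e / 2)) => t tT.
  by move/cvgrPdist_le/(_ _ e20): (sT _ tT); apply: filterS => k /=; rewrite distrC.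
exists (s m); first exact: s0.
move=> t tT; rewrite -(subrKA (u n t)) (le_trans (ler_normD _ _))//.
by rewrite [e in _ <= e]splitr lerD ?hm ?hn.
Qed.

Lemma eq_laplace_limit T f g :
  {in T, f =1 g} -> laplace_limit T f -> laplace_limit T g.
Proof.
by move=> fg [s [s0 sT]]; exists s; split=> // t tT; rewrite -fg//; apply: sT.
Qed.

Lemma laplace_limit_exp T (a : R) : laplace_limit T (fun t => expR (a * t)).
Proof.
exists (fun=> [:: (1, a)]); split=> [n|t tT] /=; first by rewrite ler01.
under eq_fun do rewrite /expsum big_seq1 mul1r; exact: cvg_cst.
Qed.

Lemma laplace_limit_cst T (c : R) : 0 <= c -> laplace_limit T (fun=> c).
Proof.
move=> c0; exists (fun=> [:: (c, 0)]); split=> [n|t tT] /=; first by rewrite c0.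
under eq_fun do rewrite /expsum big_seq1 /= mul0r expR0 mulr1; exact: cvg_cst.
Qed.

Lemma laplace_limitD T f g : laplace_limit T f -> laplace_limit T g ->
  laplace_limit T (fun t => f t + g t).
Proof.
move=> [s [s0 sT]] [r [r0 rT]]; exists (fun n => s n ++ r n); split.
  by move=> n; rewrite all_cat s0 r0.
move=> t tT; under eq_fun do rewrite /expsum big_cat.
by apply: cvgD; [exact: sT|exact: rT].
Qed.

(** The product of two exponential sums is again one, exponents adding up:
this is the convolution of the underlying measures. *)
Lemma laplace_limitM T f g : laplace_limit T f -> laplace_limit T g ->
  laplace_limit T (fun t => f t * g t).
Proof.
move=> [s [s0 sT]] [r [r0 rT]].
exists (fun n => [seq (w.1 * v.1, w.2 + v.2) | w <- s n, v <- r n]); split.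
  move=> n; apply/allP => _ /allpairsP[[w v] /= [ws vr ->]] /=.
  by rewrite mulr_ge0// ?(allP (s0 n) _ ws)// (allP (r0 n) _ vr).
move=> t tT.
suff -> : (fun n => expsum [seq (w.1 * v.1, w.2 + v.2) | w <- s n, v <- r n] t)
   = (fun n => expsum (s n) t * expsum (r n) t).
  by apply: cvgM; [exact: sT|exact: rT].
apply/funext => n; rewrite /expsum big_allpairs_dep mulr_suml.
apply: eq_bigr => w _; rewrite mulr_sumr; apply: eq_bigr => v _ /=.
by rewrite mulrDl expRD; ring.
Qed.

Lemma laplace_limitZ T c f : 0 <= c -> laplace_limit T f ->
  laplace_limit T (fun t => c * f t).
Proof. by move=> c0; apply: laplace_limitM; exact: laplace_limit_cst. Qed.

Lemma laplace_limitX T f n : laplace_limit T f ->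
  laplace_limit T (fun t => f t ^+ n).
Proof.
move=> Tf; elim: n => [|n IH].
  by apply: eq_laplace_limit (laplace_limit_cst T ler01) => t _; rewrite expr0.
by apply: eq_laplace_limit (laplace_limitM Tf IH) => t _; rewrite exprS.
Qed.

Lemma laplace_limit_sum T (u : nat -> R -> R) n :
  (forall k, laplace_limit T (u k)) ->
  laplace_limit T (fun t => \sum_(k < n) u k t).
Proof.
move=> Tu; elim: n => [|n IH].
  by apply: eq_laplace_limit (laplace_limit_cst T (lexx 0)) => t _; rewrite big_ord0.
by apply: eq_laplace_limit (laplace_limitD IH (Tu n)) => t _; rewrite big_ord_recr.
Qed.

(** The exponential series has nonnegative coefficients. *)
Lemma laplace_limit_expR T f : laplace_limit T f ->
  laplace_limit T (fun t => expR (f t)).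
Proof.
move=> Tf; apply: (@laplace_limit_lim T (fun n t => series (exp_coeff (f t)) n)).
  move=> n; apply: (@eq_laplace_limit _ (fun t => \sum_(k < n) k`!%:R^-1 * f t ^+ k)).
    move=> t _; rewrite /series /= big_mkord; apply: eq_bigr => k _.
    by rewrite /exp_coeff /= mulrC.
  apply: (@laplace_limit_sum T (fun k t => k`!%:R^-1 * f t ^+ k)) => k.
  by apply: laplace_limitZ; rewrite ?invr_ge0 ?ler0n//; exact: laplace_limitX.
by move=> t tT; exact: is_cvg_series_exp_coeff.
Qed.

(** All positive powers of exp(g) are in the class, which is what makes the
kernel exp(g(x + y)) infinitely divisible. *)
Definition log_laplace T g : Prop :=
  forall r, 0 < r -> laplace_limit T (fun t => expR (r * g t)).

Lemma laplace_limit_log T f : laplace_limit T f -> log_laplace T f.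
Proof.
by move=> Tf r r0; apply/laplace_limit_expR/laplace_limitZ => //; exact: ltW.
Qed.

(** Constants of any sign and linear terms are harmless: they multiply by a
positive constant and shift all exponents. *)
Lemma log_laplace_affine T a b : log_laplace T (fun t => a * t + b).
Proof.
move=> r r0; apply: (@eq_laplace_limit _ (fun t => expR (r * b) * expR (r * a * t))).
  by move=> t _; rewrite -expRD; congr expR; ring.
by apply: laplace_limitZ; [exact: expR_ge0|exact: laplace_limit_exp].
Qed.

Lemma log_laplaceD T f g : log_laplace T f -> log_laplace T g ->
  log_laplace T (fun t => f t + g t).
Proof.
move=> Tf Tg r r0; apply: eq_laplace_limit (laplace_limitM (Tf r r0) (Tg r r0)).
by move=> t _; rewrite -expRD mulrDr.
Qed.

Lemma log_laplaceZ T c f : 0 < c -> log_laplace T f ->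
  log_laplace T (fun t => c * f t).
Proof.
move=> c0 Tf r r0; apply: eq_laplace_limit (Tf (r * c) (mulr_gt0 r0 c0)).
by move=> t _; rewrite mulrA.
Qed.

Lemma eq_log_laplace T f g : {in T, f =1 g} -> log_laplace T f ->
  log_laplace T g.
Proof.
move=> fg Tf r r0; apply: eq_laplace_limit (Tf r r0) => t tT.
by rewrite fg.
Qed.

Lemma log_laplace_sum T (u : nat -> R -> R) n :
  (forall k, log_laplace T (u k)) ->
  log_laplace T (fun t => \sum_(k < n) u k t).
Proof.
move=> Tu; elim: n => [|n IH].
  apply: eq_log_laplace (log_laplace_affine T 0 0) => t _.
  by rewrite big_ord0 mul0r addr0.
by apply: eq_log_laplace (log_laplaceD IH (Tu n)) => t _; rewrite big_ord_recr.
Qed.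

Lemma log_laplace_lim T (u : nat -> R -> R) g :
  (forall n, log_laplace T (u n)) ->
  {in T, forall t, (fun n => u n t) @ \oo --> g t} -> log_laplace T g.
Proof.
move=> Tu ug r r0; apply: laplace_limit_lim (fun n => Tu n r r0) _ => t tT.
apply: continuous_cvg; first exact: continuous_expR.
by apply: cvgM; [exact: cvg_cst|exact: ug].
Qed.
End LaplaceLimits.

(** * Reaching t ln t by Riemann sums *)

Section Riemann.
Variable R : realType.
Implicit Types (T : seq R) (t : R).
Local Open Scope classical_set_scope.

(** The hypothesis says that on each cell the increment of the primitive [F] is
sandwiched between the two rectangles given by a nonincreasing [f]; the errors
telescope. *)
Lemma riemann_sum_bound (f F : R -> R) (a h : R) (M : nat) :
  (forall k : nat, h * f (a + k.+1%:R * h) <=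
     F (a + k.+1%:R * h) - F (a + k%:R * h) <= h * f (a + k%:R * h)) ->
  0 <= \sum_(k < M) h * f (a + k%:R * h) - (F (a + M%:R * h) - F a)
    <= h * (f a - f (a + M%:R * h)).
Proof.
move=> H; elim: M => [|M /andP[IH1 IH2]].
  by rewrite big_ord0 mul0r addr0 !subrr mulr0 lexx.
rewrite big_ord_recr /=; have /andP[] := H M.
move: IH1 IH2; rewrite mulrBr mulrBr => *; apply/andP; split; lra.
Qed.
(** With N = n + 1, the mesh is 1/N^2 and N^3 cells cover a length N. The square
matters: integrating - ln(t + s) leaves an error mesh * ln(1 + N/t), which is
O(1/N) by the crude bound ln(1 + x) <= x. *)
Definition mesh (n : nat) : R := (n.+1%:R ^+ 2)^-1.

Lemma mesh_gt0 n : 0 < mesh n. Proof. by rewrite invr_gt0 exprn_gt0. Qed.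

Lemma mesh_le n : mesh n <= n.+1%:R^-1.
Proof.
by rewrite lef_pV2 ?posrE ?exprn_gt0 ?ltr0Sn// expr2 ler_peMl ?ler0n// ler1n.
Qed.

Lemma riemann_sum_cube (f F : R -> R) (a : R) (n : nat) :
  (forall s, a <= s ->
     mesh n * f (s + mesh n) <= F (s + mesh n) - F s <= mesh n * f s) ->
  let E := \sum_(k < n.+1 ^ 3) mesh n * f (a + k%:R * mesh n)
           - (F (a + n.+1%:R) - F a) in
  0 <= E /\ E <= mesh n * (f a - f (a + n.+1%:R)).
Proof.
move=> fF.
have Nh : (n.+1 ^ 3)%:R * mesh n = n.+1%:R :> R.
  by rewrite /mesh natrX; field; rewrite nat1r pnatr_eq0.
rewrite -Nh; apply/andP; apply: (@riemann_sum_bound f F) => k.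
have -> : a + k.+1%:R * mesh n = a + k%:R * mesh n + mesh n by rewrite -natr1; ring.
by apply: fF; rewrite lerDl mulr_ge0 ?ler0n ?(ltW (mesh_gt0 n)).
Qed.

Lemma ln_chord (s u : R) : 0 < s -> 0 < u -> ln u - ln s <= (u - s) / s.
Proof.
move=> s0 u0; rewrite -ln_div ?posrE//.
have us : u / s = 1 + (u - s) / s by field; rewrite gt_eqF.
rewrite {1}us le_ln1Dx// -subr_gt0 opprK addrC -us divr_gt0//.
Qed.

(** The Riemann sums of the integral of e^(-s (t + a)) over s > 0, truncated at
s = N. *)
Lemma laplace_limit_inv T (a : R) : 0 <= a -> {in T, forall t, 0 < t} ->
  laplace_limit T (fun t => (t + a)^-1).
Proof.
move=> a0 T0; pose h := mesh; have h0 : forall n, 0 < h n := mesh_gt0.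
apply: (@laplace_limit_lim _ _ (fun n t => \sum_(k < n.+1 ^ 3)
     h n * expR (- (t + a) * (k%:R * h n)))).
  move=> n; apply: (laplace_limit_sum (u := fun k t =>
    h n * expR (- (t + a) * (k%:R * h n)))) => k.
  apply: (laplace_limitZ (ltW (h0 n))).
  apply: eq_laplace_limit (laplace_limitZ (expR_ge0 (- (a * (k%:R * h n))))
     (laplace_limit_exp T (- (k%:R * h n)))) => t _.
  by rewrite -expRD; congr expR; ring.
move=> t /T0 t0; have c0 : 0 < t + a by rewrite ltr_pwDl.
move: (t + a) c0 => c c0 {t t0 a a0}.
apply: (@cvg_harmonic_bound _ _ _ (1 + (c ^+ 2)^-1)) => n.
have [|] := @riemann_sum_cube (fun s => expR (- c * s))
  (fun s => - (expR (- c * s) / c)) 0 n.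
  move=> s _; rewrite -/(h n).
  have -> : - c * (s + h n) = - c * s + - (c * h n) by ring.
  rewrite expRD.
  have e0 := expR_gt0 (- c * s); set e := expR (- c * s) in e0 *.
  have hc0 : 0 < c * h n by rewrite mulr_gt0.
  have E1 := expR_ge1Dx (- (c * h n)).
  have E2 : (1 + c * h n) * expR (- (c * h n)) <= 1.
    by rewrite expRN ler_pdivrMr ?expR_gt0// mul1r expR_ge1Dx.
  set q := expR (- (c * h n)) in E1 E2 *.
  have -> : - (e * q / c) - - (e / c) = (1 - q) / c * e.
    by field; rewrite gt_eqF.
  rewrite [e * q]mulrC mulrA; apply/andP; split; apply: ler_wpM2r; rewrite ?(ltW e0)//.
    by rewrite ler_pdivlMr//; lra.
  by rewrite ler_pdivrMr//; lra.
rewrite -/(h n) !add0r mulr0 expR0.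
under eq_bigr => k _ do rewrite add0r.
set S := \sum_(_ < _) _; set q := expR (- c * _).
have q0 : 0 < q by exact: expR_gt0.
have qN : q / c <= (c ^+ 2)^-1 / n.+1%:R.
  have cN : 0 < c * n.+1%:R by rewrite mulr_gt0.
  have : q <= (c * n.+1%:R)^-1.
    rewrite /q mulNr expRN lef_pV2 ?posrE ?expR_gt0//.
    by apply: le_trans (expR_ge1Dx _); rewrite lerDr.
  rewrite -(ler_pM2r (x := c^-1)) ?invr_gt0// => /le_trans; apply.
  by rewrite -invfM -invfM lef_pV2 ?posrE ?mulr_gt0 ?exprn_gt0//; lra.
have hN : h n * (1 - q) <= n.+1%:R^-1.
  apply: le_trans (mesh_le n); rewrite -/(h n) ger_pMr//.
  by rewrite lerBlDr lerDl ltW.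
have h1 : 0 < (n.+1%:R : R)^-1 by rewrite invr_gt0.
have qc : 0 < q / c by rewrite divr_gt0.
have g1 : 0 <= (c ^+ 2)^-1 / n.+1%:R by apply: le_trans qN; exact: ltW.
rewrite mul1r => H1 H2; rewrite ler_norml [(1 + _) / _]mulrDl mul1r.
move: qN hN h1 qc g1 H1 H2.
move: (q / c) (_ * (1 - q)) ((c ^+ 2)^-1 / n.+1%:R) (n.+1%:R^-1) => z e g i *.
by apply/andP; split; lra.
Qed.

(** The integral of 1/(t + a + s) over [0, N] is ln(t + a + N) - ln(t + a), and
ln(t + a + N) - ln N tends to 0. *)
Lemma log_laplace_ln T (a : R) : 0 <= a -> {in T, forall t, 0 < t} ->
  log_laplace T (fun t => - ln (t + a)).
Proof.
move=> a0 T0; pose h := mesh; have h0 : forall n, 0 < h n := mesh_gt0.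
apply: (@log_laplace_lim _ _ (fun n t => \sum_(k < n.+1 ^ 3)
     h n * (t + a + k%:R * h n)^-1 + (0 * t - ln n.+1%:R))).
  move=> n; apply: log_laplaceD; last exact: log_laplace_affine.
  apply: (log_laplace_sum (u := fun k t => h n * (t + a + k%:R * h n)^-1)) => k.
  apply: log_laplaceZ => //; apply: laplace_limit_log.
  have ak : 0 <= a + k%:R * h n by rewrite addr_ge0// mulr_ge0// ltW.
  by apply: eq_laplace_limit (laplace_limit_inv ak T0) => t _; rewrite addrA.
move=> t /[dup] tT /T0 t0; have c0 : 0 < t + a by rewrite ltr_pwDl.
under eq_fun do rewrite mul0r add0r.
move: (t + a) c0 => c c0 {t t0 tT a a0}.
apply: (@cvg_harmonic_bound _ _ _ (c^-1 + c)) => n.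
have [|] := @riemann_sum_cube (fun s => s^-1) (@ln R) c n.
  move=> s cs; rewrite -/(h n); have s0 : 0 < s by apply: lt_le_trans cs.
  have sh0 : 0 < s + h n by rewrite addr_gt0.
  have := ln_chord s0 sh0; have := ln_chord sh0 s0.
  have -> : (s - (s + h n)) / (s + h n) = - (h n / (s + h n)).
    by rewrite -mulNr; congr (_ / _); ring.
  have -> : (s + h n - s) / s = h n / s by congr (_ / _); ring.
  by move=> *; apply/andP; split; lra.
rewrite -/(h n); set S := \sum_(_ < _) _ => H1 H2.
have N0 : 0 < n.+1%:R :> R by [].
have cN0 : 0 < c + n.+1%:R by rewrite addr_gt0.
have L1 := ln_chord N0 cN0.
have L2 : ln n.+1%:R <= ln (c + n.+1%:R) by rewrite ler_ln ?posrE// lerDr ltW.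
have L3 : (c + n.+1%:R - n.+1%:R) / n.+1%:R = c / n.+1%:R.
  by congr (_ / _); ring.
have L4 : h n * (c^-1 - (c + n.+1%:R)^-1) <= c^-1 / n.+1%:R.
  rewrite mulrC; apply: ler_pM; rewrite ?mesh_le ?(ltW (h0 n))//.
    by rewrite subr_ge0 lef_pV2 ?posrE// lerDl ltW.
  by rewrite lerBlDr lerDl invr_ge0 ltW.
have L5 : 0 < c^-1 / n.+1%:R by rewrite divr_gt0 ?invr_gt0.
have L6 : 0 < c / n.+1%:R by rewrite divr_gt0.
rewrite ler_norml [(_ + c) / _]mulrDl; move: L1; rewrite L3 => L1.
have {H2 L4} := le_trans H2 L4; clearbody S; clear L3.
move: (n.+1%:R : R) N0 cN0 L1 L2 L5 L6 H1 => N *.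
by apply/andP; split; lra.
Qed.

(** A primitive of - ln is s - s ln s, so the integral of - ln(t + s) over
[0, N] is t ln t + N - (t + N) ln(t + N); moreover (t + N) ln(t + N) differs
from (t + N) ln N + t by at most t^2 / N. *)
Lemma log_laplace_xlnx T : {in T, forall t, 0 < t} ->
  log_laplace T (fun t => t * ln t).
Proof.
move=> T0; pose h := mesh; have h0 : forall n, 0 < h n := mesh_gt0.
apply: (@log_laplace_lim _ _ (fun n t => \sum_(k < n.+1 ^ 3)
     h n * - ln (t + k%:R * h n)
   + ((1 + ln n.+1%:R) * t + (n.+1%:R * ln n.+1%:R - n.+1%:R)))).
  move=> n; apply: log_laplaceD; last exact: log_laplace_affine.
  apply: (log_laplace_sum (u := fun k t => h n * - ln (t + k%:R * h n))) => k.
  apply: log_laplaceZ => //; apply: log_laplace_ln => //.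
  by rewrite mulr_ge0// ltW.
move=> c /T0 c0.
apply: (@cvg_harmonic_bound _ _ _ (c^-1 + c ^+ 2)) => n.
have [|] := @riemann_sum_cube (fun s => - ln s) (fun s => s - s * ln s) c n.
  move=> s cs; rewrite -/(h n); have s0 : 0 < s by apply: lt_le_trans cs.
  have sh0 : 0 < s + h n by rewrite addr_gt0.
  have := ln_chord s0 sh0; have := ln_chord sh0 s0.
  rewrite !ler_pdivlMr//; have := h0 n => *; apply/andP; split; lra.
rewrite -/(h n); set S := \sum_(_ < _) _.
have N0 : 0 < n.+1%:R :> R by [].
have cN0 : 0 < c + n.+1%:R by rewrite addr_gt0.
set N : R := n.+1%:R in N0 cN0 *.
have L1 := ln_chord N0 cN0.
have L2 := ln_chord cN0 N0.
have L3 : ln (c + N) - ln c <= N / c.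
  by apply: le_trans (ln_chord c0 cN0) _; rewrite addrAC subrr add0r.
have L4 : h n * (- ln c - - ln (c + N)) <= c^-1 / N.
  have -> : c^-1 / N = h n * (N / c).
    by rewrite /h /mesh -/N; move: (N) N0 => x x0; field; rewrite !gt_eqF.
  by rewrite ler_pM2l//; lra.
have L5 : 0 < c^-1 / N by rewrite divr_gt0 ?invr_gt0.
have L6 : 0 < c ^+ 2 / N by rewrite divr_gt0 ?exprn_gt0.
have L7 : c <= (c + N) * (ln (c + N) - ln N).
  by move: L2; rewrite ler_pdivlMr//; lra.
have L8 : (c + N) * (ln (c + N) - ln N) <= c + c ^+ 2 / N.
  have -> : c + c ^+ 2 / N = (c + N) * ((c + N - N) / N).
    by move: (N) N0 => x x0; field; rewrite gt_eqF.
  by rewrite ler_pM2l.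
rewrite ler_norml [(_ + c ^+ 2) / _]mulrDl => H1 H2.
have {H2 L4} H3 := le_trans H2 L4; clearbody S N.
by apply/andP; split; lra.
Qed.
End Riemann.

(** * Determinants: Andreief's identity *)

Section Andreief.
Variable F : comPzRingType.

(** Multilinearity in the rows, without discarding the repeated choices. *)
Lemma det_mulmx_rect k N (U : 'M[F]_(k, N)) (V : 'M[F]_(N, k)) :
  \det (U *m V) =
  \sum_(phi : {ffun 'I_k -> 'I_N}) \prod_i U i (phi i) * \det (rowsub phi V).
Proof.
pose UV (s : 'S_k) i l := U i l * V l (s i).
transitivity (\sum_(phi : {ffun 'I_k -> 'I_N}) \sum_(s : 'S_k)
    (-1) ^+ s * \prod_i UV s i (phi i)).
  rewrite exchange_big; apply: eq_bigr => /= s _; rewrite -big_distrr /=.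
  congr (_ * _); rewrite -(bigA_distr_bigA (UV s)) /=.
  by apply: eq_bigr => i _; rewrite mxE.
apply: eq_bigr => phi _; rewrite big_distrr /=; apply: eq_bigr => s _.
rewrite mulrCA big_split //=; congr (_ * (_ * _)).
by apply: eq_bigr => i _; rewrite mxE.
Qed.

(** Averaging [det_mulmx_rect] over the permutations of the rows completes the
product of entries into a determinant. This is the Cauchy-Binet formula with
every k-subset counted k! times. *)
Lemma andreief k N (U : 'M[F]_(k, N)) (V : 'M[F]_(N, k)) :
  \det (U *m V) *+ k`! =
  \sum_(phi : {ffun 'I_k -> 'I_N}) \det (colsub phi U) * \det (rowsub phi V).
Proof.
have detUV (s : 'S_k) : \det (U *m V) = \sum_(phi : {ffun 'I_k -> 'I_N})
    (-1) ^+ s * \prod_i colsub phi U i (s i) * \det (rowsub phi V).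
  pose act (s : 'S_k) (phi : {ffun 'I_k -> 'I_N}) := [ffun i => phi (s i)].
  have actK : cancel (act s) (act s^-1)%g.
    by move=> phi; apply/ffunP => i; rewrite !ffunE permKV.
  rewrite det_mulmx_rect (reindex_inj (can_inj actK)); apply: eq_bigr => phi _.
  have -> : rowsub (act s phi) V = row_perm s (rowsub phi V).
    by apply/matrixP => i j; rewrite !mxE ffunE.
  rewrite row_permE det_mulmx det_perm mulrA [_ * _ ^+ s]mulrC.
  by congr (_ * _ * _); apply: eq_bigr => i _; rewrite mxE ffunE.
rewrite -card_Sn -sumr_const (eq_bigr _ (fun s _ => detUV s)) exchange_big /=.
by apply: eq_bigr => phi _; rewrite mulr_suml.
Qed.
End Andreief.

(** * Determinants of exponentials *)

Section ExponentialDeterminants.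
Variable R : realType.

(** Subtracting from each column its predecessor turns the row of ones into
(1, 0, ..., 0). *)
Lemma det_row1_diff (F : comNzRingType) k (M : 'M[F]_k.+1) :
  (forall j, M 0 j = 1) ->
  \det M = \det (\matrix_(i < k, j < k)
    (M (lift 0 i) (lift 0 j) - M (lift 0 i) (widen_ord (leqnSn k) j))).
Proof.
move=> M1.
(* Right multiplication by U is the column operation. *)
pose U : 'M[F]_k.+1 := \matrix_(i, j) ((i == j)%:R - (i.+1 == j :> nat)%:R).
have detU : \det U = 1.
  rewrite -det_tr det_trig; last first.
    apply/is_trig_mxP => i j ij; rewrite !mxE.
    by rewrite -val_eqE /= gtn_eqF// gtn_eqF ?subrr// ltnS ltnW.
  by rewrite big1// => i _; rewrite !mxE eqxx gtn_eqF// subr0.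
have MU i j : (M *m U) i j =
    M i j - (if unlift 0 j is Some j' then M i (widen_ord (leqnSn k) j') else 0).
  rewrite mxE; under eq_bigr do rewrite mxE mulrBr; rewrite sumrB; congr (_ - _).
    rewrite (bigD1 j)//= eqxx mulr1 big1 ?addr0// => l /negPf->.
    by rewrite mulr0.
  case: unliftP => [j' ->|->]; last by rewrite big1// => l _; rewrite mulr0.
  rewrite (bigD1 (widen_ord (leqnSn k) j'))//= eqxx mulr1 big1 ?addr0// => l.
  by rewrite -val_eqE /= /bump /= add1n eqSS => /negPf->; rewrite mulr0.
rewrite -[LHS]mulr1 -detU -det_mulmx (expand_det_row _ 0) big_ord_recl.
rewrite big1 ?addr0 => [|j _]; last first.
  by rewrite MU liftK !M1 subrr mul0r.
rewrite MU unlift_none M1 subr0 mul1r /cofactor addn0 expr0 mul1r.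
by congr (\det _); apply/matrixP => i j; rewrite 2![LHS]mxE MU liftK [RHS]mxE.
Qed.

Lemma is_derive_expsum k (a c : 'I_k -> R) (v : R) :
  is_derive v 1 (fun v => \sum_i c i * expR (a i * v))
    (\sum_i c i * (a i * expR (a i * v))).
Proof.
pose f i (v : R) := c i * expR (a i * v).
have -> : (fun v => \sum_i c i * expR (a i * v)) = \sum_i f i.
  by apply/funext => w; rewrite fct_sumE.
apply: is_derive_sum => i; rewrite /f.
have Ha : is_derive v 1 (fun v : R => a i * v) (a i).
  rewrite -[X in is_derive _ _ _ X]mulr1; exact: is_deriveZ.
have He : is_derive v 1 (fun v : R => expR (a i * v)) (a i * expR (a i * v)).
  rewrite mulrC; exact: is_derive1_comp.
exact: is_deriveZ.
Qed.

(** The form in which the mean value theorem is used on one column of a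
determinant, the [c i] being the cofactors of that column. *)
Lemma expsum_MVT k (a c : 'I_k -> R) (x y : R) : x < y ->
  exists2 v, x < v < y &
   \sum_i (expR (a i * y) - expR (a i * x)) * c i =
   (\sum_i a i * expR (a i * v) * c i) * (y - x).
Proof.
move=> xy; pose f (v : R) := \sum_i c i * expR (a i * v).
have df v := is_derive_expsum a c v.
have [|v vxy fv] := @MVT R f _ x y xy (fun v _ => df v).
  apply: continuous_subspaceT => v.
  by apply: differentiable_continuous; apply/derivable1_diffP; case: (df v).
exists v; first by move: vxy; rewrite in_itv.
transitivity (f y - f x).
  by rewrite -sumrB; apply: eq_bigr => i _; rewrite -mulrBr mulrC.
by rewrite fv; congr (_ * _); apply: eq_bigr => i _; rewrite mulrC.
Qed.

(** The determinant is a function of each column separately, so the mean value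
theorem can replace the columns of differences one at a time by columns of
derivatives at intermediate points. *)
Lemma det_exp_diff_gt0 k (b : 'I_k -> R) (x y : 'I_k -> R) :
  (forall j, x j < y j) ->
  (forall u : 'I_k -> R, (forall j, x j < u j < y j) ->
     0 < \det (\matrix_(i, j) (b i * expR (b i * u j)))) ->
  0 < \det (\matrix_(i, j) (expR (b i * y j) - expR (b i * x j))).
Proof.
move=> xy Hu.
(* The columns before s are differences, the others are derivatives. *)
pose mixed (s : nat) (u : 'I_k -> R) : 'M[R]_k := \matrix_(i, j)
  if (j < s)%N then expR (b i * y j) - expR (b i * x j)
  else b i * expR (b i * u j).
suff H s : (s <= k)%N -> forall u : 'I_k -> R, (forall j, x j < u j < y j) ->
    0 < \det (mixed s u).
  have := H k (leqnn k) (fun j => (x j + y j) / 2).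
  have -> : mixed k (fun j => (x j + y j) / 2) =
      \matrix_(i, j) (expR (b i * y j) - expR (b i * x j)).
    by apply/matrixP => i j; rewrite !mxE ltn_ord.
  by apply=> j; have := xy j; lra.
elim: s => [_ u xuy|s IH sk u xuy].
  have -> : mixed 0 u = \matrix_(i, j) (b i * expR (b i * u j)).
    by apply/matrixP => i j; rewrite !mxE.
  exact: Hu.
pose j0 := Ordinal sk.
(* The two matrices differ in column s only, hence share these cofactors. *)
pose c i := cofactor (mixed s.+1 u) i j0.
have [v vxy E] := expsum_MVT b c (xy j0).
pose u' j := if j == j0 then v else u j.
have xu'y j : x j < u' j < y j by rewrite /u'; case: eqP => [->|].
have -> : \det (mixed s.+1 u) = \det (mixed s u') * (y j0 - x j0).
  rewrite !(expand_det_col _ j0).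
  under eq_bigr do rewrite mxE ltnSn.
  rewrite E; congr (_ * _); apply: eq_bigr => i _; rewrite mxE /= ltnn /u' eqxx.
  congr (_ * (_ * \det _)); apply/matrixP => i' j'; rewrite !mxE.
  have /negPf jj : lift j0 j' != j0 by rewrite eq_sym neq_lift.
  have /negPf jj' : (lift j0 j' : nat) != s by rewrite -[s]/(val j0) val_eqE jj.
  by rewrite jj ltnS leq_eqVlt jj'.
by rewrite mulr_gt0 ?subr_gt0//; apply: IH => //; exact: ltnW.
Qed.

(** Induction on the size: factoring e^(a_0 x_j) out of the columns makes the
first row constant, [det_row1_diff] lowers the size and leaves differences of
exponentials, and [det_exp_diff_gt0] brings these back to exponentials at points
which are still increasing, because they are interlaced with the x_j. *)
Lemma det_exp_gt0 k (a x : 'I_k -> R) :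
  {homo a : i j / (i < j)%N >-> i < j} ->
  {homo x : i j / (i < j)%N >-> i < j} ->
  0 < \det (\matrix_(i, j) expR (a i * x j)).
Proof.
elim: k a x => [|k IH] a x ainc xinc; first by rewrite det_mx00.
pose b (i : 'I_k.+1) := a i - a 0.
have -> : \matrix_(i, j) expR (a i * x j) =
    (\matrix_(i, j) expR (b i * x j)) *m diag_mx (\row_j expR (a 0 * x j)).
  apply/matrixP => i j; rewrite mul_mx_diag !mxE -expRD.
  by congr expR; rewrite /b; ring.
rewrite det_mulmx det_diag; apply: mulr_gt0; last first.
  by apply: prodr_gt0 => i _; rewrite mxE expR_gt0.
rewrite det_row1_diff; last by move=> j; rewrite mxE /b subrr mul0r expR0.
pose b' i := b (lift 0 i).
pose xl (j : 'I_k) := x (widen_ord (leqnSn k) j).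
pose xr (j : 'I_k) := x (lift 0 j).
rewrite [X in \det X](_ : _ =
    \matrix_(i, j) (expR (b' i * xr j) - expR (b' i * xl j))); last first.
  by apply/matrixP => i j; rewrite !mxE.
apply: det_exp_diff_gt0 => [j|u xu]; first by apply: xinc; rewrite /= /bump.
have -> : \matrix_(i, j) (b' i * expR (b' i * u j)) =
    diag_mx (\row_i b' i) *m \matrix_(i, j) expR (b' i * u j).
  by apply/matrixP => i j; rewrite mul_diag_mx !mxE.
rewrite det_mulmx det_diag; apply: mulr_gt0.
  by apply: prodr_gt0 => i _; rewrite mxE subr_gt0 ainc.
apply: IH => [i j ij|i j ij]; first by rewrite ltrD2r ainc// ltnS.
have /andP[_ ui] := xu i; have /andP[uj _] := xu j.
apply: lt_le_trans ui _; apply: le_trans (ltW uj); rewrite /xr /xl.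
have [e|ne] := eqVneq (lift 0 i : 'I_k.+1) (widen_ord (leqnSn k) j).
  by rewrite e.
apply/ltW/xinc; rewrite ltn_neqAle; apply/andP; split => //.
Qed.

(** If two exponents agree both determinants vanish; otherwise sorting the
exponents multiplies both by the same signature and makes them positive. *)
Lemma det_exp_same_sign k (a x y : 'I_k -> R) :
  {homo x : i j / (i < j)%N >-> i < j} ->
  {homo y : i j / (i < j)%N >-> i < j} ->
  0 <= \det (\matrix_(i, j) expR (a i * x j)) *
       \det (\matrix_(i, j) expR (a i * y j)).
Proof.
move=> xinc yinc; have [ainj|/injectivePn] := boolP (injectiveb (finfun a)); last first.
  case=> i [j ij]; rewrite !ffunE => aij.
  rewrite (determinant_alternate ij) ?mul0r// => l; by rewrite !mxE aij.
have {}ainj : injective a by move=> i j e; apply: (injectiveP _ ainj); rewrite !ffunE.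
have [s sinc] : exists s : 'S_k, {homo a \o s : i j / (i < j)%N >-> i < j}.
  have srt : perm_eq (sort <=%R (codom a)) (codom a) by rewrite perm_sort.
  pose t := [tuple a i | i < k]; pose st := [tuple of sort <=%R t].
  have /tuple_permP[s sE] : perm_eq st t by rewrite perm_sort.
  exists s => i j ij.
  have E l : (a \o s) l = nth 0 st l.
    by rewrite sE -tnth_nth !tnth_mktuple.
  rewrite !E lt_neqAle; apply/andP; split.
    by rewrite -!E /= (inj_eq ainj) (inj_eq perm_inj) neq_ltn ij.
  apply: (sorted_leq_nth le_trans lexx); rewrite ?sort_le_sorted ?inE ?size_tuple// ltnW//.
pose E (z : 'I_k -> R) : 'M[R]_k := \matrix_(i, j) expR (a (s i) * z j).
have detE z : \det (\matrix_(i, j) expR (a i * z j)) = (-1) ^+ s * \det (E z).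
  have -> : E z = row_perm s (\matrix_(i, j) expR (a i * z j)).
    by apply/matrixP => i j; rewrite !mxE.
  by rewrite row_permE det_mulmx det_perm mulrA -signr_addb addbb mul1r.
rewrite !detE mulrACA -signr_addb addbb mul1r.
by rewrite mulr_ge0// ltW// det_exp_gt0.
Qed.
End ExponentialDeterminants.

(** * Kernels f(x + y) for limits of exponential sums *)

Section Kernels.
Variable R : realType.
Local Open Scope classical_set_scope.

Lemma laplace_limit_grid (f : R -> R) k (x y : 'I_k -> R) :
  (forall T, {in T, forall t, 0 < t} -> laplace_limit T f) ->
  (forall i, 0 < x i) -> (forall i, 0 < y i) ->
  exists s : nat -> seq (R * R),
    (forall n, all (fun w => 0 <= w.1) (s n)) /\
    (forall i j, (fun n => expsum (s n) (x i + y j)) @ \oo --> f (x i + y j)).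
Proof.
move=> fL x0 y0.
have [|s [s0 sT]] := fL [seq x i + y j | i <- enum 'I_k, j <- enum 'I_k].
  by move=> _ /allpairsP[[i j] /= [_ _ ->]]; rewrite addr_gt0.
exists s; split=> // i j; apply: sT.
by apply/allpairsP; exists (i, j); rewrite !mem_enum.
Qed.

Lemma cvgr_sum (I : finType) (u : I -> nat -> R) (l : I -> R) :
  (forall i, u i @ \oo --> l i) ->
  (fun n => \sum_i u i n) @ \oo --> \sum_i l i.
Proof. by move=> ul; apply: cvg_big => //; exact: add_continuous. Qed.

Lemma cvgr_prod (I : finType) (u : I -> nat -> R) (l : I -> R) :
  (forall i, u i @ \oo --> l i) ->
  (fun n => \prod_i u i n) @ \oo --> \prod_i l i.
Proof. by move=> ul; apply: cvg_big => //; exact: mul_continuous. Qed.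

(** For a single exponential the form is the square of sum_i c_i e^(a x_i). *)
Lemma laplace_limit_psd (f : R -> R) k (x c : 'I_k -> R) :
  (forall T, {in T, forall t, 0 < t} -> laplace_limit T f) ->
  (forall i, 0 < x i) ->
  0 <= \sum_i \sum_j c i * c j * f (x i + x j).
Proof.
move=> fL x0; have [s [s0 sf]] := laplace_limit_grid fL x0 x0.
apply: (@cvgr_to_ge _ \oo _ _
    (fun n => \sum_i \sum_j c i * c j * expsum (s n) (x i + x j))).
  apply: cvgr_sum => i; apply: cvgr_sum => j.
  by apply: cvgM; [exact: cvg_cst|exact: sf].
apply: nearW => n.
have -> : \sum_i \sum_j c i * c j * expsum (s n) (x i + x j) =
    \sum_(w <- s n) w.1 * (\sum_i c i * expR (w.2 * x i)) ^+ 2.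
  under eq_bigr do under eq_bigr do rewrite mulr_sumr.
  under eq_bigr do rewrite exchange_big.
  rewrite exchange_big; apply: eq_bigr => w _; rewrite expr2 big_distrlr mulr_sumr.
  apply: eq_bigr => i _; rewrite mulr_sumr; apply: eq_bigr => j _.
  by rewrite mulrDr expRD /=; ring.
rewrite big_seq; apply: sumr_ge0 => w ws.
by rewrite mulr_ge0 ?sqr_ge0// (allP (s0 n) _ ws).
Qed.

Lemma det_expsum_ge0 k (s : seq (R * R)) (x y : 'I_k -> R) :
  all (fun w => 0 <= w.1) s ->
  {homo x : i j / (i < j)%N >-> i < j} ->
  {homo y : i j / (i < j)%N >-> i < j} ->
  0 <= \det (\matrix_(i, j) expsum s (x i + y j)).
Proof.
move=> s0 xinc yinc; pose a (l : 'I_(size s)) := (nth (0, 0) s l).2.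
pose w (l : 'I_(size s)) := (nth (0, 0) s l).1.
pose U : 'M[R]_(k, size s) := \matrix_(i, l) expR (a l * x i).
pose V : 'M[R]_(size s, k) := \matrix_(l, j) (w l * expR (a l * y j)).
have -> : \matrix_(i, j) expsum s (x i + y j) = U *m V.
  apply/matrixP => i j; rewrite !mxE /expsum (big_nth (0, 0)) big_mkord.
  by apply: eq_bigr => l _; rewrite !mxE mulrDr expRD mulrCA.
rewrite -(pmulrn_lge0 _ (fact_gt0 k)) andreief; apply: sumr_ge0 => phi _.
rewrite -det_tr.
have -> : (colsub phi U)^T = \matrix_(i, j) expR (a (phi i) * x j).
  by apply/matrixP => i j; rewrite !mxE.
have -> : rowsub phi V = diag_mx (\row_i w (phi i)) *m
    \matrix_(i, j) expR (a (phi i) * y j).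
  by apply/matrixP => i j; rewrite mul_diag_mx !mxE.
rewrite det_mulmx det_diag mulrCA mulr_ge0//.
  by apply: prodr_ge0 => i _; rewrite mxE; exact: (all_nthP _ s0).
exact: (det_exp_same_sign (a \o phi)).
Qed.

Lemma laplace_limit_det_ge0 (f : R -> R) k (x y : 'I_k -> R) :
  (forall T, {in T, forall t, 0 < t} -> laplace_limit T f) ->
  (forall i, 0 < x i) -> (forall i, 0 < y i) ->
  {homo x : i j / (i < j)%N >-> i < j} ->
  {homo y : i j / (i < j)%N >-> i < j} ->
  0 <= \det (\matrix_(i, j) f (x i + y j)).
Proof.
move=> fL x0 y0 xinc yinc; have [s [s0 sf]] := laplace_limit_grid fL x0 y0.
apply: (@cvgr_to_ge _ \oo _ _
    (fun n => \det (\matrix_(i, j) expsum (s n) (x i + y j)))).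
  apply: cvgr_sum => p; apply: cvgM; first exact: cvg_cst.
  apply: cvgr_prod => i; rewrite mxE.
  by under eq_fun do rewrite mxE; exact: sf.
by apply: nearW => n; exact: det_expsum_ge0.
Qed.

(** A vector annihilating a semidefinite form is orthogonal to everything: here
the form is bordered by the extra point [y], and evaluated at the coefficient of
[y] which minimizes it. *)
Lemma laplace_limit_kernel (f : R -> R) k (x c : 'I_k -> R) (y : R) :
  (forall T, {in T, forall t, 0 < t} -> laplace_limit T f) ->
  (forall i, 0 < x i) -> 0 < y -> 0 < f (y + y) ->
  \sum_i \sum_j c i * c j * f (x i + x j) = 0 ->
  \sum_i c i * f (x i + y) = 0.
Proof.
move=> fL x0 y0 fy Q0; set G := \sum_i _.
(* The minimizer of 2 e G + e^2 f(2y), where the form takes the value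
   - G^2 / f(2y). *)
pose e := - G / f (y + y).
pose x' (i : 'I_k.+1) := if unlift ord0 i is Some j then x j else y.
pose c' (i : 'I_k.+1) := if unlift ord0 i is Some j then c j else e.
have x'0 i : 0 < x' i by rewrite /x'; case: unliftP.
have := laplace_limit_psd c' fL x'0.
have x'l i : x' (lift ord0 i) = x i by rewrite /x' liftK.
have c'l i : c' (lift ord0 i) = c i by rewrite /c' liftK.
have -> : \sum_i \sum_j c' i * c' j * f (x' i + x' j) = - (G ^+ 2 / f (y + y)).
  rewrite big_ord_recl big_ord_recl.
  rewrite [c' ord0]/c' [x' ord0]/x' unlift_none.
  have -> : \sum_(i < k) e * c' (lift ord0 i) * f (y + x' (lift ord0 i)) = e * G.
    rewrite mulr_sumr; apply: eq_bigr => i _.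
    by rewrite c'l x'l -mulrA [y + _]addrC.
  have -> : \sum_(i < k) \sum_(j < k.+1)
      c' (lift ord0 i) * c' j * f (x' (lift ord0 i) + x' j) = e * G.
    under eq_bigr do rewrite big_ord_recl.
    rewrite big_split /= [X in _ + X](_ : _ = 0) ?addr0; last first.
      rewrite -[RHS]Q0; apply: eq_bigr => i _; apply: eq_bigr => j _.
      by rewrite !c'l !x'l.
    rewrite mulr_sumr; apply: eq_bigr => i _.
    by rewrite c'l x'l [c' ord0]/c' [x' ord0]/x' unlift_none mulrAC mulrC.
  by rewrite /e; field; rewrite gt_eqF.
rewrite oppr_ge0 pmulr_lle0 ?invr_gt0// => G2.
by apply/eqP; rewrite -sqrf_eq0 eq_le G2 sqr_ge0.
Qed.

End Kernels.

(** * The kernel (x + y)^(x + y) *)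

Section PowerKernel.
Variable R : realType.
Local Open Scope classical_set_scope.

Lemma laplace_limit_selfpow (r : R) T : 0 < r -> {in T, forall t, 0 < t} ->
  laplace_limit T (fun t => (t `^ t) `^ r).
Proof.
move=> r0 T0; apply: eq_laplace_limit (log_laplace_xlnx T0 r0) => t /T0 t0.
by rewrite -powRrM /powR gt_eqF//; congr expR; ring.
Qed.

(** The ratio is at most (b + y)^(a - b). Taking y exponentially large in n
makes this at most e^(-(b - a)(n + 1)). *)
Lemma selfpow_ratio_le (a b y : R) (n : nat) : 0 < a < b -> y = expR n.+1%:R ->
  (a + y) `^ (a + y) / (b + y) `^ (b + y) <= (b - a)^-1 / n.+1%:R.
Proof.
move=> /andP[a0 ab] yE; have y0 : 0 < y by rewrite yE expR_gt0.
have ay : 0 < a + y by rewrite addr_gt0.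
have by0 : 0 < b + y by rewrite addr_gt0// (lt_trans a0).
have N0 : 0 < n.+1%:R :> R by [].
have ba : 0 < b - a by rewrite subr_gt0.
rewrite /powR !gt_eqF// -expRB.
have L1 : ln (a + y) <= ln (b + y) by rewrite ler_ln ?posrE// lerD2r ltW.
have L2 : n.+1%:R <= ln (b + y).
  by rewrite -[leLHS](@expRK R) -yE ler_ln ?posrE// lerDr (ltW (lt_trans a0 ab)).
have L3 := ler_wpM2l (ltW ay) L1.
have L4 := ler_wpM2l (ltW ba) L2.
apply: le_trans (_ : expR (- ((b - a) * n.+1%:R)) <= _).
  by rewrite ler_expR; move: L3 L4; move: (n.+1%:R : R) (ln _) (ln _) => *; lra.
rewrite expRN -invfM lef_pV2 ?posrE ?expR_gt0 ?mulr_gt0//.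
by apply: le_trans (expR_ge1Dx _); rewrite lerDr.
Qed.

(** Divide the relation by the value at the last index with a nonzero
coefficient and let y tend to infinity. *)
Lemma selfpow_independent n (p c : 'I_n -> R) : (forall i, 0 < p i) ->
  {homo p : i j / (i < j)%N >-> i < j} ->
  (forall y, 0 < y -> \sum_i c i * (p i + y) `^ (p i + y) = 0) ->
  forall i, c i = 0.
Proof.
move=> p0 pinc H i0; apply/eqP/negPn/negP => ci0.
have [m cm mmax] := @arg_maxnP _ i0 (fun i => c i != 0) (@nat_of_ord n) ci0.
pose f (t : R) := t `^ t.
pose y (l : nat) : R := expR l.+1%:R.
have y0 l : 0 < y l by exact: expR_gt0.
have f0 i l : 0 < f (p i + y l) by rewrite powR_gt0// addr_gt0.
have lim : (fun l => \sum_i c i * (f (p i + y l) / f (p m + y l))) @ \oo -->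
    \sum_i (if i == m then c m else 0).
  apply: cvgr_sum => i; have [->|im] := eqVneq i m.
    under eq_fun do rewrite divff ?mulr1 ?gt_eqF//; exact: cvg_cst.
  have [mi|im'|/val_inj e] := ltngtP m i.
  - have -> : c i = 0.
      by apply/eqP/negPn/negP => /mmax /=; rewrite leqNgt mi.
    under eq_fun do rewrite mul0r; exact: cvg_cst.
  - rewrite -(mulr0 (c i)); apply: cvgM; first exact: cvg_cst.
    apply: (@cvg_harmonic_bound _ _ _ (p m - p i)^-1) => l.
    rewrite subr0 ger0_norm ?divr_ge0 ?(ltW (f0 _ _))//.
    by apply: selfpow_ratio_le => //; rewrite p0 pinc.
  - by rewrite e eqxx in im.
have lim0 : (fun l => \sum_i c i * (f (p i + y l) / f (p m + y l))) @ \oo --> (0 : R).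
  have -> : (fun l => \sum_i c i * (f (p i + y l) / f (p m + y l))) = fun=> 0.
    apply/funext => l; under eq_bigr do rewrite mulrA.
    by rewrite -mulr_suml H// mul0r.
  exact: cvg_cst.
have : \sum_i (if i == m then c m else 0) = 0.
  exact: (norm_cvg_unique lim lim0).
rewrite -big_mkcond big_pred1_eq => e.
by move: cm; rewrite /= e eqxx.
Qed.
End PowerKernel.

Theorem mainTheorem1 (R : realType) (n : nat) (n_ge1 : (1 <= n)%N)
    (p : 'I_n -> R) (p_gt0 : forall i, 0 < p i)
    (p_incr : forall i j : 'I_n, (i < j)%N -> p i < p j) :
  let B : 'M[R]_n := powsum_mx p in
  [/\ infinitely_divisible B, B \in unitmx & totally_positive B].
Proof.
move=> B.
have fL (T : seq R) : {in T, forall t, 0 < t} -> laplace_limit T (fun t => t `^ t).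
  move=> T0; apply: eq_laplace_limit (laplace_limit_selfpow ltr01 T0) => t _.
  by rewrite powRr1// powR_ge0.
have Bsym : B^T = B by apply/matrixP => i j; rewrite !mxE addrC.
have B0 i j : 0 <= B i j by rewrite mxE powR_ge0.
split.
- split=> // r r0; split; first by apply/matrixP => i j; rewrite !mxE addrC.
  move=> x; have := laplace_limit_psd (fun i => x i 0)
    (fun T => @laplace_limit_selfpow R r T r0) p_gt0.
  congr (0 <= _); rewrite mxE; apply: eq_bigr => i _.
  rewrite !mxE mulr_sumr; apply: eq_bigr => j _.
  by rewrite !mxE mulrAC -mulrA.
- rewrite unitmxE unitfE; apply/negP => /det0P[v /eqP v0 vB]; apply: v0.
  have Q0 : \sum_i \sum_j v 0 i * v 0 j * (p i + p j) `^ (p i + p j) = 0.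
    rewrite exchange_big big1// => j _.
    have /rowP/(_ j) := vB; rewrite !mxE => e.
    transitivity (v 0 j * \sum_i v 0 i * B i j); last by rewrite e mulr0.
    rewrite mulr_sumr; apply: eq_bigr => i _.
    by rewrite !mxE mulrCA mulrA.
  apply/rowP => i; rewrite mxE.
  apply: (selfpow_independent p_gt0 p_incr) => y y0.
  apply: (laplace_limit_kernel fL) => //.
  by rewrite powR_gt0// addr_gt0.
- split=> // k f g finc ginc.
  have -> : mxsub f g B = \matrix_(i, j) (p (f i) + p (g j)) `^ (p (f i) + p (g j)).
    by apply/matrixP => i j; rewrite !mxE.
  apply: (laplace_limit_det_ge0 (x := p \o f) (y := p \o g) fL) => //=.
  + by move=> i j /finc /p_incr.
  + by move=> i j /ginc /p_incr.
Qed.
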